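(* Let $X$ be an admissible linear subspace of $\mathcal{H}(\mathbb{D})$. Let $A,B$ be meromorphic functions in $\mathbb{D}$ and let $C\in\mathcal{H}(\mathbb{D})$, $C\not\equiv0$, be such that $AC\in X''$ and $B+C'/C\in X'$. Then each analytic solution $g\in\mathcal{H}(\mathbb{D})$ of the Riccati differential equation $$g''=A+B\,g'+C\,(g')^2$$ satisfies $Cg'\in X'$.
   Context: $\mathcal{H}(\mathbb{D})$ is the space of analytic functions in the unit disc $\mathbb{D}=\{z\in\mathbb{C}:|z|<1\}$. For $X\subset\mathcal{H}(\mathbb{D})$, $X'=\{f':f\in X\}$ and $X''=\{f'':f\in X\}$; in particular the hypotheses require $AC$ and $B+C'/C$ to be analytic in $\mathbb{D}$ (after removing removable singularities), although $A$ and $B$ themselves may have poles. The differential equation is understood as an identity of meromorphic functions in $\mathbb{D}$. For $g\in\mathcal{H}(\mathbb{D})$ define $R(g)(z)=\int_0^z\int_0^\zeta\big(-g''(\xi)-g'(\xi)^2\big)\,d\xi\,d\zeta$, $z\in\mathbb{D}$. A linear subspace $X\subset\mathcal{H}(\mathbb{D})$ is called admissible if it contains all polynomials (restricted to $\mathbb{D}$) and, for all $g\in\mathcal{H}(\mathbb{D})$, one has $g\in X$ if and only if $R(g)\in X$. *)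

(* Defs.v *)
From Stdlib Require Import Reals.
From Coquelicot Require Import Coquelicot.

Local Open Scope C_scope.

(** Functions on the unit disc are represented by total functions [C -> C]
    whose values outside the disc are irrelevant.  Meromorphic functions take
    arbitrary values at their poles. *)

Definition unit_disc (z : C) : Prop := (Cmod z < 1)%R.

Definition eq_on_disc (f g : C -> C) : Prop :=
  forall z, unit_disc z -> f z = g z.

Definition analytic_at (f : C -> C) (a : C) : Prop :=
  exists c : nat -> C, locally a (fun z => is_pseries c (z - a) (f z)).

Definition analytic_on_disc (f : C -> C) : Prop :=
  forall a, unit_disc a -> analytic_at f a.

Definition meromorphic_at (f : C -> C) (a : C) : Prop :=
  exists (n : nat) (h : C -> C), analytic_at h a /\
    locally' a (fun z => (z - a) ^ n * f z = h z).

Definition meromorphic_on_disc (f : C -> C) : Prop :=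
  forall a, unit_disc a -> meromorphic_at f a.

(** Equality of meromorphic functions: [f] and [g] coincide on the disc outside
    a set of isolated points without accumulation point in the disc. *)
Definition mero_eq (f g : C -> C) : Prop :=
  forall a, unit_disc a -> locally' a (fun z => f z = g z).

(** [C_derive f z] is the complex derivative wherever [f] is complex
    differentiable ([C_derive_correct]). *)
Definition first_derivatives (X : (C -> C) -> Prop) (F : C -> C) : Prop :=
  exists f, X f /\ eq_on_disc F (C_derive f).

Definition second_derivatives (X : (C -> C) -> Prop) (F : C -> C) : Prop :=
  exists f, X f /\ eq_on_disc F (C_derive (C_derive f)).

(** [F] belongs to [Y] once its removable singularities have been removed. *)
Definition mem_removing_singularities (Y : (C -> C) -> Prop) (F : C -> C)
  : Prop :=
  exists G, Y G /\ mero_eq F G.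

(** The integral of [f] along the straight segment from [0] to [z]; for [f]
    analytic in the disc it is the path-independent integral. *)
Definition integral_from_0 (f : C -> C) (z : C) : C :=
  RInt (V := C_R_CompleteNormedModule) (fun t : R => z * f (RtoC t * z)) 0 1.

Definition riccati_op (g : C -> C) : C -> C :=
  integral_from_0 (integral_from_0
    (fun xi => - C_derive (C_derive g) xi - C_derive g xi ^ 2)).

(** A complex linear subspace of the space of analytic functions in the disc;
    [subspace_ext] makes membership depend only on the restriction to the
    disc. *)
Record linear_subspace (X : (C -> C) -> Prop) : Prop := {
  subspace_analytic : forall f, X f -> analytic_on_disc f;
  subspace_ext : forall f g, eq_on_disc f g -> X f -> X g;
  subspace_zero : X (fun _ => 0);
  subspace_add : forall f g, X f -> X g -> X (fun z => f z + g z);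
  subspace_scal : forall (k : C) f, X f -> X (fun z => k * f z)
}.

Record admissible (X : (C -> C) -> Prop) : Prop := {
  admissible_subspace : linear_subspace X;
  admissible_poly : forall (n : nat) (c : nat -> C),
    X (fun z => sum_n (fun k => c k * z ^ k) n);
  admissible_riccati : forall g, analytic_on_disc g ->
    (X g <-> X (riccati_op g))
}.

(* Main.v *)
(** Put [w = Cf g'] and write [A Cf = f1''], [B + Cf'/Cf = f2'] with [f1, f2] in
    [X]. The Riccati equation becomes [w' = f1'' + f2' w + w^2]; the poles have
    disappeared, so by continuity it holds at every point of the disc. Let
    [h' = w]. Completing the square, [v = - h - f2/2] satisfies
    [- v'' - v'^2 = f1'' + f2''/2 - f2'^2/4], and the right-hand side is also
    [f1'' + f2'' - u'' - u'^2] with [u = f2/2]. Hence [R(v)] equals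
    [f1 + f2 + R(u)] up to a polynomial of degree one, so [R(v)] and then [v] and
    [h] lie in [X].

    No Cauchy theorem is needed: a power series satisfies the bound
    [|f y - f x - (y - x) f' x| <= K |y - x|^2] near its centre, and compactness of
    a radius then allows one to differentiate [integral_from_0 f] under the
    integral sign. *)

Require Import Defs.
From Stdlib Require Import Reals Lra Lia ClassicalEpsilon.
From Coquelicot Require Import Coquelicot.

Local Open Scope C_scope.

(** * Complex derivatives and segments *)

(** [C] carries two uniform structures: the product one of [C_UniformSpace], with squares as balls,
    used by [analytic_at], and the one induced by [Cmod], used for the estimates. They have the same
    neighbourhoods by [locally_C]. *)
Local Notation CU := (AbsRing_UniformSpace C_AbsRing).
Local Notation CV := (AbsRing_NormedModule C_AbsRing).
Definition is_Cderive (f : C -> C) (z l : C) : Prop :=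
  is_derive (K := C_AbsRing) (V := CV) f z l.

Definition Ccontinuous (f : C -> C) (z : C) : Prop :=
  continuous (T := CU) (U := CU) f z.

Lemma locally_Cmod (a : C) (P : C -> Prop) :
  locally (T := C_UniformSpace) a P <->
  exists d : posreal, forall z, (Cmod (z - a) < d)%R -> P z.
Proof. apply locally_C. Qed.

Lemma locally'_Cmod (a : C) (P : C -> Prop) :
  locally' (T := C_UniformSpace) a P <->
  exists d : posreal, forall z, (Cmod (z - a) < d)%R -> z <> a -> P z.
Proof. apply locally_C. Qed.

Lemma C_derive_unique (f : C -> C) (z l : C) :
  is_Cderive f z l -> C_derive f z = l.
Proof.
  (* Both normed modules on [C] share their norm, so the limit clause [H] transfers unchanged; only
     the linearity clause is proved anew. *)
  intros [_ H]. apply is_C_derive_unique. split; [|exact H].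
  apply (is_linear_scal_l (V := C_NormedModule)).
Qed.

Lemma is_Cderive_mult (f g : C -> C) (z l m : C) :
  is_Cderive f z l -> is_Cderive g z m ->
  is_Cderive (fun y => f y * g y) z (l * g z + f z * m).
Proof. intros Hf Hg. exact (is_derive_mult (K := C_AbsRing) f g z l m Hf Hg Cmult_comm). Qed.

Lemma is_Cderive_plus (f g : C -> C) (z l m : C) :
  is_Cderive f z l -> is_Cderive g z m ->
  is_Cderive (fun y => f y + g y) z (l + m).
Proof. intros Hf Hg. exact (is_derive_plus (V := CV) f g z l m Hf Hg). Qed.

Lemma is_Cderive_ext_near (f g : C -> C) (z l : C) (d : posreal) :
  (forall y, (Cmod (y - z) < d)%R -> f y = g y) ->
  is_Cderive f z l -> is_Cderive g z l.
Proof. intros H. apply is_derive_ext_loc. exists d. exact H. Qed.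

Lemma is_Cderive_const (k z : C) : is_Cderive (fun _ => k) z 0.
Proof. exact (is_derive_const (V := CV) k z). Qed.

Lemma is_Cderive_id (z : C) : is_Cderive (fun y => y) z 1.
Proof. exact (is_derive_id (K := C_AbsRing) z). Qed.

Lemma is_Cderive_scal (k : C) (f : C -> C) (z l : C) :
  is_Cderive f z l -> is_Cderive (fun y => k * f y) z (k * l).
Proof.
  intros Hf. replace (k * l) with (0 * f z + k * l) by ring.
  apply (is_Cderive_mult (fun _ => k)); [apply is_Cderive_const | exact Hf].
Qed.

Lemma is_Cderive_continuous (f : C -> C) (z l : C) :
  is_Cderive f z l -> Ccontinuous f z.
Proof. intros H. apply (ex_derive_continuous (V := CV) f z). now exists l. Qed.

Lemma Ccontinuous_const (k z : C) : Ccontinuous (fun _ => k) z.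
Proof. exact (continuous_const (U := CU) (V := CU) k z). Qed.

Lemma Ccontinuous_plus (f g : C -> C) (z : C) :
  Ccontinuous f z -> Ccontinuous g z -> Ccontinuous (fun y => f y + g y) z.
Proof. exact (continuous_plus (U := CU) (V := CV) f g z). Qed.

Lemma Ccontinuous_mult (f g : C -> C) (z : C) :
  Ccontinuous f z -> Ccontinuous g z -> Ccontinuous (fun y => f y * g y) z.
Proof. exact (continuous_mult (U := CU) (K := C_AbsRing) f g z). Qed.

Lemma Ccontinuous_eps (f : C -> C) (z : C) : Ccontinuous f z ->
  forall eps : posreal, exists d : posreal,
  forall y, (Cmod (y - z) < d)%R -> (Cmod (f y - f z) < eps)%R.
Proof.
  intros H eps.
  destruct (proj1 (filterlim_locally (F := locally (T := CU) z) (U := CU) f (f z)) H eps) as [d Hd].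
  exists d. exact Hd.
Qed.

Lemma is_Cderive_eps (f : C -> C) (z l : C) :
  (forall eps : posreal, exists d : posreal, forall y, (Cmod (y - z) < d)%R ->
     (Cmod (f y - f z - (y - z) * l) <= eps * Cmod (y - z))%R) ->
  is_Cderive f z l.
Proof.
  intros H; split.
  - apply (is_linear_scal_l (V := CV)).
  - intros x Hx.
    rewrite <- (is_filter_lim_locally_unique (V := CV) z x Hx).
    intros eps. destruct (H eps) as [d Hd]. exists d. exact Hd.
Qed.

Lemma is_Cderive_eps_inv (f : C -> C) (z l : C) :
  is_Cderive f z l ->
  forall eps : posreal, exists d : posreal, forall y, (Cmod (y - z) < d)%R ->
     (Cmod (f y - f z - (y - z) * l) <= eps * Cmod (y - z))%R.
Proof.
  intros [_ H] eps.
  destruct (H z (fun P h => h) eps) as [d Hd]. exists d. exact Hd.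
Qed.

Lemma continuous_along_segment (k : C -> C) (a v : C) (t : R) :
  Ccontinuous k (a + t * v) ->
  continuous (U := C_R_NormedModule) (fun s : R => k (a + s * v)) t.
Proof.
  intros Hk.
  apply (continuous_comp (V := C_UniformSpace) (W := C_UniformSpace) (fun s : R => a + s * v) k).
  - apply (continuous_plus (V := C_R_NormedModule)).
    + apply continuous_const.
    + apply (continuous_ext (U := C_R_NormedModule) (fun s : R => scal s (v : C_R_NormedModule))).
      * intros s. apply scal_R_Cmult.
      * apply (continuous_scal_l (V := C_R_NormedModule) (fun s : R => s) v t).
        apply continuous_id.
  - intros P HP. apply locally_C. apply Hk. now apply locally_C.
Qed.

Lemma is_derive_along_segment (f : C -> C) (a v l : C) (t : R) :
  is_Cderive f (a + t * v) l ->
  is_derive (V := C_R_NormedModule) (fun s : R => f (a + s * v)) t (v * l).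
Proof.
  intros H; split.
  - apply (is_linear_scal_l (V := C_R_NormedModule)).
  - intros x Hx.
    rewrite <- (is_filter_lim_locally_unique (V := R_NormedModule) t x Hx).
    intros eps.
    (* Dividing by [Cmod v + 1] instead of [Cmod v] also covers the degenerate direction [v = 0]. *)
    assert (Hv : (0 < Cmod v + 1)%R) by (pose proof (Cmod_ge_0 v); lra).
    assert (Heps : (0 < eps / (Cmod v + 1))%R)
      by (apply Rdiv_lt_0_compat; [apply cond_pos | exact Hv]).
    destruct (is_Cderive_eps_inv _ _ _ H (mkposreal _ Heps)) as [d Hd].
    assert (Hd' : (0 < d / (Cmod v + 1))%R)
      by (apply Rdiv_lt_0_compat; [apply cond_pos | exact Hv]).
    exists (mkposreal _ Hd'). intros s Hs.
    change (Rabs (s - t) < d / (Cmod v + 1))%R in Hs.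
    assert (E : (Cmod ((a + s * v) - (a + t * v)) = Rabs (s - t) * Cmod v)%R).
    { rewrite <- Cmod_R, <- Cmod_mult. f_equal. rewrite RtoC_minus. ring. }
    assert (B : (Cmod ((a + s * v) - (a + t * v)) < d)%R).
    { rewrite E. apply Rlt_div_r in Hs; [|exact Hv].
      pose proof (Rabs_pos (s - t)). nra. }
    specialize (Hd _ B). simpl in Hd. rewrite E in Hd.
    change (Rle (norm (V := C_R_NormedModule) (f (a + s * v) - f (a + t * v)
      - scal (V := C_R_ModuleSpace) (s - t)%R (v * l))) (eps * Rabs (s - t))).
    rewrite <- Cmod_norm, scal_R_Cmult, RtoC_minus.
    replace (f (a + s * v) - f (a + t * v) - (s - t) * (v * l))
      with (f (a + s * v) - f (a + t * v) - (a + s * v - (a + t * v)) * l) by ring.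
    eapply Rle_trans; [exact Hd|].
    replace (eps / (Cmod v + 1) * (Rabs (s - t) * Cmod v))%R
      with ((eps * Rabs (s - t)) * (Cmod v / (Cmod v + 1)))%R by (field; lra).
    rewrite <- (Rmult_1_r (eps * Rabs (s - t))) at 2.
    apply Rmult_le_compat_l.
    + apply Rmult_le_pos; [apply Rlt_le, cond_pos | apply Rabs_pos].
    + apply Rle_div_l; lra.
Qed.

(** Fundamental theorem of calculus for the real-variable function [F (a + t * v)], whose derivative
    is [v * f (a + t * v)] by the chain rule. *)
Lemma is_RInt_segment (F f : C -> C) (a v : C) :
  (forall t : R, (0 <= t <= 1)%R ->
     is_Cderive F (a + t * v) (f (a + t * v)) /\ Ccontinuous f (a + t * v)) ->
  is_RInt (V := C_R_CompleteNormedModule)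
    (fun t : R => v * f (a + t * v)) 0 1 (F (a + v) - F a).
Proof.
  intros H.
  replace (F (a + v) - F a) with (F (a + RtoC 1 * v) - F (a + RtoC 0 * v)).
  - apply (is_RInt_derive (V := C_R_CompleteNormedModule) (fun t : R => F (a + t * v))).
    + intros t Ht. rewrite Rmin_left, Rmax_right in Ht by lra.
      apply is_derive_along_segment. now apply H.
    + intros t Ht. rewrite Rmin_left, Rmax_right in Ht by lra.
      apply (continuous_along_segment (fun w => v * f w)).
      apply Ccontinuous_mult; [apply Ccontinuous_const | now apply H].
  - f_equal; [|f_equal]; f_equal; ring.
Qed.

(** * Complex series *)

Definition is_Cseries (u : nat -> C) (l : C) : Prop :=
  is_series (K := C_AbsRing) (V := C_NormedModule) u l.

Lemma Re_sum_n (u : nat -> C) (n : nat) :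
  Re (sum_n (G := C_AbelianMonoid) u n) = sum_n (fun k => Re (u k)) n.
Proof.
  induction n as [|n IH].
  - now rewrite !sum_O.
  - rewrite !sum_Sn, <- IH. apply re_plus.
Qed.

Lemma Im_sum_n (u : nat -> C) (n : nat) :
  Im (sum_n (G := C_AbelianMonoid) u n) = sum_n (fun k => Im (u k)) n.
Proof.
  induction n as [|n IH].
  - now rewrite !sum_O.
  - rewrite !sum_Sn, <- IH. apply im_plus.
Qed.

(** Balls of [C_NormedModule] are products of real balls, so convergence is componentwise. This
    reduces the complex Cauchy product to the real one. *)
Lemma is_Cseries_Re_Im (u : nat -> C) (l : C) :
  is_Cseries u l <->
  is_series (fun n => Re (u n)) (Re l) /\ is_series (fun n => Im (u n)) (Im l).
Proof.
  split.
  - intros H. split; intros P [e He].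
    + destruct (H (fun z => P (Re z))) as [N HN].
      { exists e. intros z Hz. apply He. apply Hz. }
      exists N. intros n Hn. rewrite <- Re_sum_n. now apply HN.
    + destruct (H (fun z => P (Im z))) as [N HN].
      { exists e. intros z Hz. apply He. apply Hz. }
      exists N. intros n Hn. rewrite <- Im_sum_n. now apply HN.
  - intros [H1 H2] P [e He].
    destruct (H1 (ball (Re l) e)) as [N1 HN1]; [now exists e|].
    destruct (H2 (ball (Im l) e)) as [N2 HN2]; [now exists e|].
    exists (max N1 N2). intros n Hn. apply He. split.
    + change (ball (Re l) e (Re (sum_n (G := C_AbelianMonoid) u n))).
      rewrite Re_sum_n. apply HN1. lia.
    + change (ball (Im l) e (Im (sum_n (G := C_AbelianMonoid) u n))).
      rewrite Im_sum_n. apply HN2. lia.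
Qed.

Lemma is_Cseries_ext (u v : nat -> C) (l : C) :
  (forall n, u n = v n) -> is_Cseries u l -> is_Cseries v l.
Proof. intros H. now apply is_series_ext. Qed.

Lemma is_Cseries_unique (u : nat -> C) (l m : C) :
  is_Cseries u l -> is_Cseries u m -> l = m.
Proof. exact (filterlim_locally_unique (V := C_NormedModule) _ l m). Qed.

Lemma is_Cseries_plus (u v : nat -> C) (l m : C) :
  is_Cseries u l -> is_Cseries v m -> is_Cseries (fun n => u n + v n) (l + m).
Proof. exact (is_series_plus (V := C_NormedModule) u v l m). Qed.

Lemma is_Cseries_scal (k : C) (u : nat -> C) (l : C) :
  is_Cseries u l -> is_Cseries (fun n => k * u n) (k * l).
Proof. exact (is_series_scal (V := C_NormedModule) k u l). Qed.

Lemma is_Cseries_shift (u : nat -> C) (l : C) :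
  is_Cseries (fun n => u (S n)) l -> is_Cseries u (u 0%nat + l).
Proof.
  intros H. apply (is_series_decr_1 (V := C_NormedModule)).
  change (is_Cseries (fun n => u (S n)) (u 0%nat + l - u 0%nat)).
  now replace (u 0%nat + l - u 0%nat) with l by ring.
Qed.

Lemma ex_Cseries_abs (u : nat -> C) :
  ex_series (fun n => Cmod (u n)) -> exists l, is_Cseries u l.
Proof.
  intros H.
  apply (ex_series_le (V := C_CompleteNormedModule) u (fun n => Cmod (u n)));
    [|exact H].
  intros n. apply Rle_refl.
Qed.

Lemma is_Cseries_Cmod_le (u : nat -> C) (b : nat -> R) (l : C) (B : R) :
  is_Cseries u l -> is_series b B -> (forall n, (Cmod (u n) <= b n)%R) ->
  (Cmod l <= B)%R.
Proof.
  intros Hu Hb Hub.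
  assert (L : is_lim_seq (fun n => Cmod (sum_n (G := C_AbelianMonoid) u n)) (Cmod l)).
  { apply (filterlim_comp _ _ _ _ Cmod _ _ _ Hu).
    exact (filterlim_norm (V := C_NormedModule) l). }
  refine (is_lim_seq_le _ _ (Cmod l) B _ L Hb).
  intros n. induction n as [|n IH].
  - rewrite !sum_O. apply Hub.
  - rewrite !sum_Sn. eapply Rle_trans; [apply Cmod_triangle|].
    apply Rplus_le_compat; [exact IH | apply Hub].
Qed.

(** Splitting into real and imaginary parts gives four real Cauchy products, recombined as [RR - II]
    and [RI + IR]. Each converges because [Cmod] dominates both parts. *)
Lemma is_Cseries_mult (u v : nat -> C) (l m : C) :
  is_Cseries u l -> is_Cseries v m ->
  ex_series (fun n => Cmod (u n)) -> ex_series (fun n => Cmod (v n)) ->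
  is_Cseries (fun n => sum_n (G := C_AbelianMonoid) (fun k => u k * v (n - k)%nat) n) (l * m).
Proof.
  intros Hu Hv Au Av.
  assert (absR : forall w : nat -> C, ex_series (fun n => Cmod (w n)) ->
    ex_series (fun n => Rabs (Re (w n)))).
  { intros w. apply (ex_series_le (V := R_CompleteNormedModule)). intros n.
    change (Rabs (Rabs (Re (w n))) <= Cmod (w n))%R. rewrite Rabs_Rabsolu.
    eapply Rle_trans; [apply Rmax_l | apply Rmax_Cmod]. }
  assert (absI : forall w : nat -> C, ex_series (fun n => Cmod (w n)) ->
    ex_series (fun n => Rabs (Im (w n)))).
  { intros w. apply (ex_series_le (V := R_CompleteNormedModule)). intros n.
    change (Rabs (Rabs (Im (w n))) <= Cmod (w n))%R. rewrite Rabs_Rabsolu.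
    eapply Rle_trans; [apply Rmax_r | apply Rmax_Cmod]. }
  apply is_Cseries_Re_Im in Hu. destruct Hu as [Ru Iu].
  apply is_Cseries_Re_Im in Hv. destruct Hv as [Rv Iv].
  pose proof (is_series_mult _ _ _ _ Ru Rv (absR _ Au) (absR _ Av)) as RR.
  pose proof (is_series_mult _ _ _ _ Iu Iv (absI _ Au) (absI _ Av)) as II.
  pose proof (is_series_mult _ _ _ _ Ru Iv (absR _ Au) (absI _ Av)) as RI.
  pose proof (is_series_mult _ _ _ _ Iu Rv (absI _ Au) (absR _ Av)) as IR.
  apply is_Cseries_Re_Im. split.
  - rewrite re_mult.
    eapply is_series_ext; [|exact (is_series_minus _ _ _ _ RR II)].
    intros n. rewrite Re_sum_n, sum_n_Reals.
    eapply eq_trans; [symmetry; apply minus_sum|].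
    apply sum_eq. intros k _. symmetry. apply re_mult.
  - rewrite im_mult.
    eapply is_series_ext; [|exact (is_series_plus _ _ _ _ RI IR)].
    intros n. rewrite Im_sum_n, sum_n_Reals.
    eapply eq_trans; [symmetry; apply plus_sum|].
    apply sum_eq. intros k _. symmetry. apply im_mult.
Qed.

(** * Differentiation of power series *)

Lemma analytic_at_series (f : C -> C) (a : C) :
  analytic_at f a <-> exists (c : nat -> C) (d : posreal),
    forall z, (Cmod (z - a) < d)%R ->
      is_Cseries (fun n => c n * (z - a) ^ n) (f z).
Proof.
  assert (E : forall (c : nat -> C) (x l : C),
    is_pseries (K := C_AbsRing) (V := C_NormedModule) c x l <->
    is_Cseries (fun n => c n * x ^ n) l).
  { intros c x l.
    assert (T : forall n, scal (V := C_ModuleSpace) (pow_n (K := C_Ring) x n) (c n) = c n * x ^ n).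
    { intros n. exact (Cmult_comm (x ^ n) (c n)). }
    split; intros H.
    - exact (is_series_ext (V := C_NormedModule) _ _ _ T H).
    - exact (is_series_ext (V := C_NormedModule) _ _ _ (fun n => eq_sym (T n)) H). }
  split; intros [c H]; exists c.
  - apply locally_Cmod in H. destruct H as [d Hd].
    exists d. intros z Hz. now apply E, Hd.
  - apply locally_Cmod. destruct H as [d Hd].
    exists d. intros z Hz. now apply E, Hd.
Qed.

Lemma is_Cseries_terms_bounded (u : nat -> C) (l : C) :
  is_Cseries u l -> exists M, forall n, (Cmod (u n) <= M)%R.
Proof.
  intros H.
  destruct (filterlim_bounded (V := C_NormedModule) (sum_n u)) as [M HM];
    [now exists l|].
  assert (HM' : forall n, (Cmod (sum_n (G := C_AbelianMonoid) u n) <= M)%R) by exact HM.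
  (* A term is the difference of two consecutive partial sums, each bounded by [M]. *)
  exists (2 * M)%R. intros n.
  pose proof (HM' n) as Hn. pose proof (Cmod_ge_0 (sum_n (G := C_AbelianMonoid) u n)).
  destruct n as [|n].
  - rewrite sum_O in Hn, H0. lra.
  - replace (u (S n)) with (sum_n (G := C_AbelianMonoid) u (S n) + - sum_n (G := C_AbelianMonoid) u n).
    + eapply Rle_trans; [apply Cmod_triangle|]. rewrite Cmod_opp.
      pose proof (HM' n). lra.
    + rewrite sum_Sn. change (sum_n (G := C_AbelianMonoid) u n + u (S n) + - sum_n (G := C_AbelianMonoid) u n = u (S n)). ring.
Qed.

(** A substitute for Cauchy's estimates: at the point [a + d / 2], inside the disc of convergence,
    the terms of a convergent series are bounded. *)
Lemma coefficients_bounded (c : nat -> C) (a : C) (f : C -> C) (d : posreal) :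
  (forall z, (Cmod (z - a) < d)%R -> is_Cseries (fun n => c n * (z - a) ^ n) (f z)) ->
  exists M, forall n, (Cmod (c n) * (d / 2) ^ n <= M)%R.
Proof.
  intros H. pose proof (cond_pos d) as Hd.
  assert (E : Cmod (a + RtoC (d / 2) - a) = (d / 2)%R).
  { replace (a + RtoC (d / 2) - a) with (RtoC (d / 2)) by ring.
    rewrite Cmod_R. apply Rabs_pos_eq. lra. }
  destruct (is_Cseries_terms_bounded _ _ (H (a + RtoC (d / 2)) ltac:(lra))) as [M HM].
  exists M. intros n. specialize (HM n).
  now rewrite Cmod_mult, Cmod_pow, E in HM.
Qed.

(** Lets the polynomial factors produced by differentiation be absorbed into the ratio of a
    geometric series. *)
Lemma INR_S_le_pow2 (n : nat) : (INR (S n) <= 2 ^ n)%R.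
Proof.
  induction n as [|n IH]; [simpl; lra|].
  rewrite S_INR. simpl pow.
  assert (1 <= 2 ^ n)%R by (apply pow_R1_Rle; lra). lra.
Qed.

Lemma ex_series_geom_bound (c : nat -> C) (M r : R) (x : C) : (0 < r)%R ->
  (forall n, (Cmod (c n) * r ^ n <= M)%R) -> (Cmod x <= r / 2)%R ->
  ex_series (fun n => Cmod (c n * x ^ n)).
Proof.
  intros Hr HM Hx.
  apply (ex_series_le (V := R_CompleteNormedModule) _ (fun n => M * (/ 2) ^ n)%R).
  - intros n. change (Rabs (Cmod (c n * x ^ n)) <= M * (/ 2) ^ n)%R.
    rewrite Rabs_pos_eq by apply Cmod_ge_0. rewrite Cmod_mult, Cmod_pow.
    assert (Cmod x ^ n <= (r * / 2) ^ n)%R.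
    { apply pow_incr. split; [apply Cmod_ge_0 | exact Hx]. }
    rewrite Rpow_mult_distr in H.
    eapply Rle_trans; [apply Rmult_le_compat_l; [apply Cmod_ge_0 | exact H]|].
    rewrite <- Rmult_assoc. apply Rmult_le_compat_r; [|apply HM].
    apply pow_le. lra.
  - apply (ex_series_scal (V := R_NormedModule) M (fun n => (/ 2) ^ n)%R).
    apply ex_series_geom. rewrite Rabs_pos_eq; lra.
Qed.

(** With [D n] the first-order Taylor remainder of the [n]-th power, [D (n+1) = y * D n + n *
    x^(n-1) * (y - x)^2], and the induction closes because [n^2 + n <= (n+1)^2]. The factor [p ^ 2]
    on the left avoids the exponent [n - 2] on the right. *)
Lemma monomial_quadratic (x y : C) (p : R) (n : nat) :
  (Cmod x <= p)%R -> (Cmod y <= p)%R ->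
  (p ^ 2 * Cmod (y ^ n - x ^ n - RtoC (INR n) * x ^ pred n * (y - x))
     <= INR n ^ 2 * p ^ n * Cmod (y - x) ^ 2)%R.
Proof.
  intros Hx Hy.
  assert (Hp : (0 <= p)%R) by (pose proof (Cmod_ge_0 x); lra).
  induction n as [|n IH].
  - replace (y ^ 0 - x ^ 0 - RtoC (INR 0) * x ^ pred 0 * (y - x)) with (RtoC 0) by (simpl; ring).
    rewrite Cmod_0. simpl. lra.
  - assert (R : y ^ S n - x ^ S n - RtoC (INR (S n)) * x ^ pred (S n) * (y - x)
      = y * (y ^ n - x ^ n - RtoC (INR n) * x ^ pred n * (y - x))
        + RtoC (INR n) * x ^ pred n * (y - x) ^ 2).
    { rewrite S_INR, RtoC_plus. destruct n as [|n]; simpl; ring. }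
    rewrite R. clear R.
    set (D := y ^ n - x ^ n - RtoC (INR n) * x ^ pred n * (y - x)) in *.
    assert (B : (p ^ 2 * Cmod (RtoC (INR n) * x ^ pred n * (y - x) ^ 2)
      <= INR n * p ^ S n * Cmod (y - x) ^ 2)%R).
    { rewrite !Cmod_mult, !Cmod_pow, Cmod_R, (Rabs_pos_eq _ (pos_INR n)).
      destruct n as [|n]; [simpl; lra|]. simpl pred.
      assert (Cmod x ^ n <= p ^ n)%R
        by (apply pow_incr; split; [apply Cmod_ge_0 | exact Hx]).
      replace (p ^ 2 * (INR (S n) * Cmod x ^ n * Cmod (y - x) ^ 2))%R
        with ((p ^ 2 * INR (S n) * Cmod (y - x) ^ 2) * Cmod x ^ n)%R by ring.
      replace (INR (S n) * p ^ S (S n) * Cmod (y - x) ^ 2)%R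
        with ((p ^ 2 * INR (S n) * Cmod (y - x) ^ 2) * p ^ n)%R by (simpl; ring).
      apply Rmult_le_compat_l; [|assumption].
      apply Rmult_le_pos; [apply Rmult_le_pos|]; try apply pow2_ge_0.
      apply pos_INR. }
    assert (A : (p ^ 2 * Cmod (y * D) <= p * (INR n ^ 2 * p ^ n * Cmod (y - x) ^ 2))%R).
    { rewrite Cmod_mult.
      replace (p ^ 2 * (Cmod y * Cmod D))%R with (Cmod y * (p ^ 2 * Cmod D))%R by ring.
      apply Rmult_le_compat; try assumption; [apply Cmod_ge_0|].
      apply Rmult_le_pos; [apply pow2_ge_0 | apply Cmod_ge_0]. }
    pose proof (Cmod_triangle (y * D) (RtoC (INR n) * x ^ pred n * (y - x) ^ 2)) as T.
    apply (Rmult_le_compat_l (p ^ 2)) in T; [|apply pow2_ge_0].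
    assert (0 <= p ^ S n * Cmod (y - x) ^ 2)%R
      by (apply Rmult_le_pos; [now apply pow_le | apply pow2_ge_0]).
    assert (0 <= INR n)%R by apply pos_INR.
    rewrite S_INR. simpl pow in *. nra.
Qed.

(** Summation of the monomial bounds. Since [n^2 <= 4^n], a coefficient bound at radius [8 * p]
    leaves the factor [2^(-n)], whose sum is the [2] in the constant. *)
Lemma series_quadratic (c : nat -> C) (M p : R) (x y fx fy g : C) : (0 < p)%R ->
  (forall n, (Cmod (c n) * (8 * p) ^ n <= M)%R) ->
  (Cmod x <= p)%R -> (Cmod y <= p)%R ->
  is_Cseries (fun n => c n * x ^ n) fx ->
  is_Cseries (fun n => c n * y ^ n) fy ->
  is_Cseries (fun n => RtoC (INR (S n)) * c (S n) * x ^ n) g ->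
  (Cmod (fy - fx - (y - x) * g) <= 2 * M / p ^ 2 * Cmod (y - x) ^ 2)%R.
Proof.
  intros Hp HM Hx Hy Sx Sy Sg.
  (* Reindexing puts the derived series in step with the other two; the added term at [n = 0]
     vanishes through [INR 0]. *)
  assert (Sg' : is_Cseries (fun n => RtoC (INR n) * c n * x ^ pred n) g).
  { replace g with (RtoC (INR 0) * c 0%nat * x ^ pred 0 + g) by (simpl; ring).
    exact (is_Cseries_shift (fun n => RtoC (INR n) * c n * x ^ pred n) g Sg). }
  replace (fy - fx - (y - x) * g) with (fy + (-1) * fx + (- (y - x)) * g) by ring.
  pose proof (is_Cseries_plus _ _ _ _
    (is_Cseries_plus _ _ _ _ Sy (is_Cseries_scal (-1) _ _ Sx))
    (is_Cseries_scal (- (y - x)) _ _ Sg')) as S.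
  apply (is_Cseries_Cmod_le _ (fun n => (M / p ^ 2 * Cmod (y - x) ^ 2) * (/ 2) ^ n)%R _ _ S).
  - replace (2 * M / p ^ 2 * Cmod (y - x) ^ 2)%R
      with ((M / p ^ 2 * Cmod (y - x) ^ 2) * / (1 - / 2))%R by (field; lra).
    apply (is_series_scal (V := R_NormedModule)).
    apply is_series_geom. rewrite Rabs_pos_eq; lra.
  - intros n.
    replace (c n * y ^ n + -1 * (c n * x ^ n) + - (y - x) * (RtoC (INR n) * c n * x ^ pred n))
      with (c n * (y ^ n - x ^ n - RtoC (INR n) * x ^ pred n * (y - x))) by ring.
    rewrite Cmod_mult.
    pose proof (monomial_quadratic x y p n Hx Hy) as Q.
    assert (N : (INR n ^ 2 * p ^ n <= (8 * p) ^ n * (/ 2) ^ n)%R).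
    { rewrite <- Rpow_mult_distr. replace (8 * p * / 2)%R with (2 ^ 2 * p)%R by field.
      rewrite Rpow_mult_distr, <- pow_mult, Nat.mul_comm, pow_mult.
      apply Rmult_le_compat_r; [apply pow_le; lra|].
      apply pow_incr. split; [apply pos_INR|].
      eapply Rle_trans; [|apply INR_S_le_pow2]. rewrite S_INR. lra. }
    set (D := Cmod (y ^ n - x ^ n - RtoC (INR n) * x ^ pred n * (y - x))) in *.
    assert (P2 : (0 < p ^ 2)%R) by (apply pow_lt; exact Hp).
    assert (Q' : (D <= (8 * p) ^ n * (/ 2) ^ n * Cmod (y - x) ^ 2 / p ^ 2)%R).
    { apply Rle_div_r; [exact P2|]. rewrite Rmult_comm. eapply Rle_trans; [exact Q|].
      apply Rmult_le_compat_r; [apply pow2_ge_0 | exact N]. }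
    eapply Rle_trans; [apply Rmult_le_compat_l; [apply Cmod_ge_0 | exact Q']|].
    replace (Cmod (c n) * ((8 * p) ^ n * (/ 2) ^ n * Cmod (y - x) ^ 2 / p ^ 2))%R
      with ((Cmod (c n) * (8 * p) ^ n) * (Cmod (y - x) ^ 2 / p ^ 2 * (/ 2) ^ n))%R
      by (field; lra).
    replace (M / p ^ 2 * Cmod (y - x) ^ 2 * (/ 2) ^ n)%R
      with (M * (Cmod (y - x) ^ 2 / p ^ 2 * (/ 2) ^ n))%R by (field; lra).
    apply Rmult_le_compat_r; [|apply HM].
    apply Rmult_le_pos; [|apply pow_le; lra].
    apply Rmult_le_pos; [apply pow2_ge_0 | apply Rlt_le, Rinv_0_lt_compat, P2].
Qed.

Lemma is_Cderive_quadratic (f : C -> C) (z l : C) (d : posreal) (K : R) :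
  (forall y, (Cmod (y - z) < d)%R ->
    (Cmod (f y - f z - (y - z) * l) <= K * Cmod (y - z) ^ 2)%R) ->
  is_Cderive f z l.
Proof.
  intros H. apply is_Cderive_eps. intros eps.
  pose proof (cond_pos eps). pose proof (cond_pos d). pose proof (Rabs_pos K).
  assert (He : (0 < eps / (Rabs K + 1))%R) by (apply Rdiv_lt_0_compat; lra).
  exists (mkposreal _ (Rmin_pos _ _ (cond_pos d) He)). intros y Hy. simpl in Hy.
  eapply Rle_trans; [apply H; eapply Rlt_le_trans; [exact Hy | apply Rmin_l]|].
  assert (Hy' : (Cmod (y - z) < eps / (Rabs K + 1))%R)
    by (eapply Rlt_le_trans; [exact Hy | apply Rmin_r]).
  apply Rlt_div_r in Hy'; [|lra].
  pose proof (Cmod_ge_0 (y - z)). pose proof (Rle_abs K).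
  simpl pow. rewrite Rmult_1_r, <- Rmult_assoc.
  apply Rmult_le_compat_r; [assumption|]. nra.
Qed.

(** The remainder bound identifies the sum of the derived series as the derivative. The constant [K]
    is the same for all [x] and [y] near [a], which later gives uniformity along a radius. *)
Lemma series_derive (c : nat -> C) (a : C) (f : C -> C) (d : posreal) :
  (forall z, (Cmod (z - a) < d)%R -> is_Cseries (fun n => c n * (z - a) ^ n) (f z)) ->
  exists (e : posreal) (K : R), forall x, (Cmod (x - a) < e)%R ->
    is_Cseries (fun n => RtoC (INR (S n)) * c (S n) * (x - a) ^ n) (C_derive f x) /\
    is_Cderive f x (C_derive f x) /\
    forall y, (Cmod (y - a) < e)%R ->
      (Cmod (f y - f x - (y - x) * C_derive f x) <= K * Cmod (y - x) ^ 2)%R.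
Proof.
  intros H. destruct (coefficients_bounded c a f d H) as [M HM].
  pose proof (cond_pos d) as Hd.
  (* With [p = d / 16], the radius [8 * p] of [series_quadratic] is the radius [d / 2] of [HM]. *)
  assert (Hp : (0 < d / 16)%R) by lra.
  exists (mkposreal _ Hp), (2 * M / (d / 16) ^ 2)%R. simpl.
  assert (Q : forall x y g, (Cmod (x - a) < d / 16)%R -> (Cmod (y - a) < d / 16)%R ->
    is_Cseries (fun n => RtoC (INR (S n)) * c (S n) * (x - a) ^ n) g ->
    (Cmod (f y - f x - (y - x) * g) <= 2 * M / (d / 16) ^ 2 * Cmod (y - x) ^ 2)%R).
  { intros x y g Hx Hy Hg.
    replace (y - x) with ((y - a) - (x - a)) by ring.
    apply (series_quadratic c M (d / 16)); try lra; try assumption.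
    - intros n. replace (8 * (d / 16))%R with (d / 2)%R by field. apply HM.
    - apply H. lra.
    - apply H. lra. }
  intros x Hx.
  assert (Hs : exists g, is_Cseries (fun n => RtoC (INR (S n)) * c (S n) * (x - a) ^ n) g).
  { apply ex_Cseries_abs.
    (* Halving the radius from [d / 2] to [d / 4] gains [2^(-n)], which pays for the factor [n + 1];
       the spare power of [d / 2] explains the bound [M / (d / 2)]. *)
    apply (ex_series_geom_bound (fun n => RtoC (INR (S n)) * c (S n)) (M / (d / 2)) (d / 4));
      [lra| |lra].
    intros n. apply (proj1 (Rle_div_r _ _ (d / 2) ltac:(lra))).
    rewrite Cmod_mult, Cmod_R, (Rabs_pos_eq _ (pos_INR _)).
    eapply Rle_trans; [|apply (HM (S n))].
    replace (d / 4)%R with (/ 2 * (d / 2))%R by field.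
    rewrite Rpow_mult_distr.
    replace (INR (S n) * Cmod (c (S n)) * ((/ 2) ^ n * (d / 2) ^ n) * (d / 2))%R
      with ((INR (S n) * (/ 2) ^ n) * (Cmod (c (S n)) * (d / 2) ^ S n))%R by (simpl; ring).
    rewrite <- Rmult_1_l. apply Rmult_le_compat_r.
    - apply Rmult_le_pos; [apply Cmod_ge_0 | apply pow_le; lra].
    - rewrite pow_inv. apply Rle_div_l; [apply pow_lt; lra|].
      rewrite Rmult_1_l. apply INR_S_le_pow2. }
  destruct Hs as [g Hg].
  assert (Dg : is_Cderive f x g).
  { assert (He : (0 < d / 16 - Cmod (x - a))%R) by lra.
    apply (is_Cderive_quadratic f x g (mkposreal _ He) (2 * M / (d / 16) ^ 2)).
    intros y Hy. simpl in Hy. apply Q; try assumption.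
    replace (y - a) with ((y - x) + (x - a)) by ring.
    pose proof (Cmod_triangle (y - x) (x - a)). lra. }
  rewrite (C_derive_unique f x g Dg).
  split; [exact Hg|]. split; [exact Dg|].
  intros y Hy. now apply Q.
Qed.

(** * Local properties of analytic functions *)

Lemma analytic_at_quadratic (f : C -> C) (a : C) : analytic_at f a ->
  exists (e : posreal) (K : R), forall x, (Cmod (x - a) < e)%R ->
    is_Cderive f x (C_derive f x) /\
    forall y, (Cmod (y - a) < e)%R ->
      (Cmod (f y - f x - (y - x) * C_derive f x) <= K * Cmod (y - x) ^ 2)%R.
Proof.
  intros H. apply analytic_at_series in H. destruct H as (c & d & H).
  destruct (series_derive c a f d H) as (e & K & E).
  exists e, K. intros x Hx. now apply E.
Qed.

Lemma analytic_at_is_Cderive (f : C -> C) (a : C) :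
  analytic_at f a -> is_Cderive f a (C_derive f a).
Proof.
  intros H. destruct (analytic_at_quadratic f a H) as (e & K & E).
  apply (E a). replace (a - a) with (RtoC 0) by ring.
  rewrite Cmod_0. apply cond_pos.
Qed.

Lemma analytic_at_continuous (f : C -> C) (a : C) :
  analytic_at f a -> Ccontinuous f a.
Proof. intros H. eapply is_Cderive_continuous, analytic_at_is_Cderive, H. Qed.

Lemma analytic_at_derive (f : C -> C) (a : C) :
  analytic_at f a -> analytic_at (C_derive f) a.
Proof.
  intros H. apply analytic_at_series in H. destruct H as (c & d & H).
  destruct (series_derive c a f d H) as (e & K & E).
  apply analytic_at_series. exists (fun n => RtoC (INR (S n)) * c (S n)), e.
  intros z Hz. now apply E.
Qed.

Lemma analytic_at_ext_near (f g : C -> C) (a : C) (d : posreal) :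
  (forall z, (Cmod (z - a) < d)%R -> f z = g z) ->
  analytic_at f a -> analytic_at g a.
Proof.
  intros E H. apply analytic_at_series in H. destruct H as (c & e & H).
  apply analytic_at_series. exists c, (mkposreal _ (Rmin_pos _ _ (cond_pos d) (cond_pos e))).
  simpl. intros z Hz.
  pose proof (Rmin_l d e). pose proof (Rmin_r d e).
  rewrite <- E by lra. apply H. lra.
Qed.

Lemma analytic_at_plus (f g : C -> C) (a : C) :
  analytic_at f a -> analytic_at g a -> analytic_at (fun z => f z + g z) a.
Proof.
  intros Hf Hg. apply analytic_at_series in Hf. destruct Hf as (c & d & Hf).
  apply analytic_at_series in Hg. destruct Hg as (b & e & Hg).
  apply analytic_at_series. exists (fun n => c n + b n), (mkposreal _ (Rmin_pos _ _ (cond_pos d) (cond_pos e))).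
  simpl. intros z Hz. pose proof (Rmin_l d e). pose proof (Rmin_r d e).
  eapply is_Cseries_ext; [|apply is_Cseries_plus; [apply Hf; lra | apply Hg; lra]].
  intros n. simpl. ring.
Qed.

Lemma analytic_at_mult (f g : C -> C) (a : C) :
  analytic_at f a -> analytic_at g a -> analytic_at (fun z => f z * g z) a.
Proof.
  intros Hf Hg. apply analytic_at_series in Hf. destruct Hf as (c & d & Hf).
  apply analytic_at_series in Hg. destruct Hg as (b & e & Hg).
  destruct (coefficients_bounded _ _ _ _ Hf) as [M HM].
  destruct (coefficients_bounded _ _ _ _ Hg) as [N HN].
  apply analytic_at_series.
  (* Coefficients are bounded at half of each radius, and absolute convergence by geometric
     comparison costs another half. *)
  assert (Hr : (0 < Rmin d e / 4)%R).
  { pose proof (Rmin_pos _ _ (cond_pos d) (cond_pos e)). lra. }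
  exists (fun n => sum_n (G := C_AbelianMonoid) (fun k => c k * b (n - k)%nat) n), (mkposreal _ Hr).
  simpl. intros z Hz.
  pose proof (Rmin_l d e). pose proof (Rmin_r d e).
  pose proof (cond_pos d). pose proof (cond_pos e).
  eapply is_Cseries_ext; [|apply is_Cseries_mult;
    [apply Hf; lra | apply Hg; lra
    | apply (ex_series_geom_bound c M (d / 2)); [lra | exact HM | lra]
    | apply (ex_series_geom_bound b N (e / 2)); [lra | exact HN | lra]]].
  intros n.
  transitivity (sum_n (G := C_AbelianMonoid) (fun k => mult (K := C_Ring) (c k * b (n - k)%nat) ((z - a) ^ n)) n).
  - apply sum_n_ext_loc. intros k Hk.
    change (c k * (z - a) ^ k * (b (n - k)%nat * (z - a) ^ (n - k)) =
      c k * b (n - k)%nat * (z - a) ^ n).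
    replace ((z - a) ^ n) with ((z - a) ^ k * (z - a) ^ (n - k))
      by (rewrite <- Cpow_add_r; f_equal; lia).
    ring.
  - apply (sum_n_mult_r (K := C_Ring)).
Qed.

Lemma analytic_at_const (k a : C) : analytic_at (fun _ => k) a.
Proof.
  apply analytic_at_series.
  exists (fun n => match n with O => k | _ => 0 end), (mkposreal 1 Rlt_0_1).
  intros z _.
  assert (Z : is_Cseries (fun n => 0 * (z - a) ^ n) 0).
  { apply (filterlim_ext (fun _ => RtoC 0)); [|apply filterlim_const].
    intros n. induction n as [|n IH].
    - rewrite sum_O. ring.
    - rewrite sum_Sn, <- IH. change (RtoC 0 = 0 + 0 * (z - a) ^ S n). ring. }
  pose proof (is_Cseries_shift
    (fun n => match n with O => k | S _ => 0 end * (z - a) ^ n) 0) as S.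
  simpl in S. replace (k * 1 + 0) with k in S by ring.
  apply S. apply (is_Cseries_ext (fun n => 0 * (z - a) ^ n)); [|exact Z].
  intros n. ring.
Qed.

Lemma analytic_at_scal (k : C) (f : C -> C) (a : C) :
  analytic_at f a -> analytic_at (fun z => k * f z) a.
Proof. intros H. apply (analytic_at_mult (fun _ => k)); [apply analytic_at_const | exact H]. Qed.

(** Termwise integration: the series with coefficients [p] converges near [a], and its derived
    series is that of [f], so uniqueness of sums gives the derivative. *)
Lemma analytic_at_primitive (f : C -> C) (a : C) : analytic_at f a ->
  exists (P : C -> C) (e : posreal), analytic_at P a /\
    forall z, (Cmod (z - a) < e)%R -> is_Cderive P z (f z).
Proof.
  intros H. apply analytic_at_series in H. destruct H as (c & d & H).
  destruct (coefficients_bounded _ _ _ _ H) as [M HM].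
  pose proof (cond_pos d) as Hd.
  set (p := fun n => match n with O => RtoC 0 | S m => c m / RtoC (INR (S m)) end).
  assert (Hp : forall n, (Cmod (p n) * (d / 2) ^ n <= M * (d / 2))%R).
  { pose proof (HM 0%nat) as M0. simpl in M0.
    pose proof (Cmod_ge_0 (c 0%nat)).
    intros [|m]; unfold p.
    - rewrite Cmod_0, Rmult_0_l. apply Rmult_le_pos; lra.
    - assert (1 <= INR (S m))%R by (rewrite S_INR; pose proof (pos_INR m); lra).
      rewrite Cmod_div by (intros E; apply RtoC_inj in E; lra).
      rewrite Cmod_R, Rabs_pos_eq by lra. simpl pow.
      replace (Cmod (c m) / INR (S m) * (d / 2 * (d / 2) ^ m))%R
        with (/ INR (S m) * (Cmod (c m) * (d / 2) ^ m) * (d / 2))%R by (field; lra).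
      apply Rmult_le_compat_r; [lra|].
      eapply Rle_trans; [|apply (HM m)].
      rewrite <- (Rmult_1_l (Cmod (c m) * (d / 2) ^ m)) at 2.
      apply Rmult_le_compat_r.
      + apply Rmult_le_pos; [apply Cmod_ge_0 | apply pow_le; lra].
      + rewrite <- Rinv_1. apply Rinv_le_contravar; lra. }
  (* [epsilon] turns the sum into a total function, with arbitrary values where the series
     diverges. *)
  set (P := fun z => epsilon (inhabits (RtoC 0)) (is_Cseries (fun n => p n * (z - a) ^ n))).
  assert (Hd4 : (0 < d / 4)%R) by lra.
  assert (HP : forall z, (Cmod (z - a) < mkposreal _ Hd4)%R ->
    is_Cseries (fun n => p n * (z - a) ^ n) (P z)).
  { intros z Hz. apply epsilon_spec, ex_Cseries_abs. simpl in Hz.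
    apply (ex_series_geom_bound p (M * (d / 2)) (d / 2)); [lra | exact Hp | lra]. }
  destruct (series_derive p a P _ HP) as (e & K & E).
  exists P, (mkposreal _ (Rmin_pos _ _ (cond_pos d) (cond_pos e))).
  split; [apply analytic_at_series; now exists p, (mkposreal _ Hd4)|].
  simpl. intros z Hz. pose proof (Rmin_l d e). pose proof (Rmin_r d e).
  destruct (E z) as (Sz & D & _); [lra|].
  replace (f z) with (C_derive P z); [exact D|].
  apply (is_Cseries_unique _ _ _ Sz).
  apply (is_Cseries_ext (fun n => c n * (z - a) ^ n)); [|apply H; lra].
  intros n. unfold p.
  assert (RtoC (INR (S n)) <> 0).
  { intros F. apply RtoC_inj in F. apply (not_0_INR (S n)); [lia | exact F]. }
  field. assumption.
Qed.

(** * Integration along radii *)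

Lemma unit_disc_scal (z : C) (t : R) :
  unit_disc z -> (0 <= t <= 1)%R -> unit_disc (t * z).
Proof.
  unfold unit_disc. intros Hz Ht.
  rewrite Cmod_mult, Cmod_R, Rabs_pos_eq by lra.
  pose proof (Cmod_ge_0 z). nra.
Qed.

Lemma unit_disc_open (a : C) : unit_disc a ->
  exists d : posreal, forall z, (Cmod (z - a) < d)%R -> unit_disc z.
Proof.
  unfold unit_disc. intros Ha.
  assert (Hd : (0 < 1 - Cmod a)%R) by lra.
  exists (mkposreal _ Hd). simpl. intros z Hz.
  replace z with ((z - a) + a) by ring.
  pose proof (Cmod_triangle (z - a) a). lra.
Qed.

(** The increment of [H] is the integral of its derivative along the segment from [a] to [z], which
    stays in the disc. *)
Lemma zero_derivative_constant (H : C -> C) (a : C) (d : posreal) :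
  (forall z, (Cmod (z - a) < d)%R -> is_Cderive H z 0) ->
  forall z, (Cmod (z - a) < d)%R -> H z = H a.
Proof.
  intros HD z Hz.
  assert (I : is_RInt (V := C_R_CompleteNormedModule)
    (fun t : R => (z - a) * 0) 0 1 (H (a + (z - a)) - H a)).
  { apply (is_RInt_segment H (fun _ => 0)). intros t Ht.
    split; [|apply Ccontinuous_const]. apply HD.
    replace (a + t * (z - a) - a) with (t * (z - a)) by ring.
    rewrite Cmod_mult, Cmod_R, Rabs_pos_eq by lra.
    pose proof (Cmod_ge_0 (z - a)). nra. }
  replace (a + (z - a)) with z in I by ring.
  pose proof (is_RInt_const (V := C_R_CompleteNormedModule) 0 1 ((z - a) * 0)) as J.
  pose proof (eq_trans (eq_sym (is_RInt_unique _ _ _ _ I)) (is_RInt_unique _ _ _ _ J)) as E.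
  rewrite scal_R_Cmult in E.
  apply Ceq_minus. rewrite E. ring.
Qed.

Lemma integral_from_0_ext (f g : C -> C) :
  eq_on_disc f g -> eq_on_disc (integral_from_0 f) (integral_from_0 g).
Proof.
  intros E z Hz. apply (RInt_ext (V := C_R_CompleteNormedModule)). intros t Ht.
  rewrite Rmin_left, Rmax_right in Ht by lra.
  rewrite E; [reflexivity|]. apply unit_disc_scal; [exact Hz | lra].
Qed.

Lemma integral_from_0_of_derivative (F f : C -> C) :
  (forall z, unit_disc z -> is_Cderive F z (f z) /\ Ccontinuous f z) ->
  eq_on_disc (integral_from_0 f) (fun z => F z - F 0).
Proof.
  intros H z Hz. apply (is_RInt_unique (V := C_R_CompleteNormedModule)).
  apply (is_RInt_ext (V := C_R_CompleteNormedModule) (fun t : R => z * f (0 + t * z))).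
  { intros t _. now rewrite Cplus_0_l. }
  cbv beta. rewrite <- (Cplus_0_l z) at 1.
  apply (is_RInt_segment F f 0 z). intros t Ht.
  rewrite Cplus_0_l. apply H. now apply unit_disc_scal.
Qed.

(** A Lebesgue number argument on the compact segment from [0] to [z]: a local property of pairs of
    points holds with one [d] for all pairs [t * z], [t * (z + h)]. *)
Lemma radius_uniformity (P : C -> C -> Prop) :
  (forall a, unit_disc a -> exists d : posreal, forall x y,
     (Cmod (x - a) < d)%R -> (Cmod (y - a) < d)%R -> P x y) ->
  forall z, unit_disc z -> exists d : posreal, forall (t : R) (h : C),
    (0 <= t <= 1)%R -> (Cmod h < d)%R -> P (t * z) (t * (z + h)).
Proof.
  intros HP z Hz.
  (* The range condition on [t] sits inside so that [delta] is defined on all of [R]. The factor [2]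
     leaves room for both moving the centre and adding [t * h]. *)
  assert (Q : forall t : R, exists d : posreal, (0 <= t <= 1)%R -> forall x y,
    (Cmod (x - t * z) < 2 * d)%R -> (Cmod (y - t * z) < 2 * d)%R -> P x y).
  { intros t. destruct (classic (0 <= t <= 1)%R) as [Ht|Ht].
    - destruct (HP _ (unit_disc_scal z t Hz Ht)) as [d Hd].
      assert (Hd' : (0 < d / 2)%R) by (pose proof (cond_pos d); lra).
      exists (mkposreal _ Hd'). simpl. intros _ x y Hx Hy. apply Hd; lra.
    - exists (mkposreal 1 Rlt_0_1). intros Ht'. contradiction. }
  set (delta := fun t => proj1_sig (constructive_indefinite_description _ (Q t))).
  assert (Hdelta : forall t : R, (0 <= t <= 1)%R -> forall x y,
    (Cmod (x - t * z) < 2 * delta t)%R -> (Cmod (y - t * z) < 2 * delta t)%R -> P x y).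
  { intros t. exact (proj2_sig (constructive_indefinite_description _ (Q t))). }
  destruct (compactness_value_1d 0 1 delta) as [d Hd].
  (* Compactness yields its centre [s], with [t] within [delta s] of [s] and [d <= delta s], only
     under a double negation. *)
  exists d. intros t h Ht Hh. apply NNPP. intros N.
  apply (Hd t Ht). intros (s & Hs & Hts & Hds). apply N.
  assert (B : (Cmod (t * z - s * z) < delta s)%R).
  { replace (t * z - s * z) with (RtoC (t - s) * z) by (rewrite RtoC_minus; ring).
    rewrite Cmod_mult, Cmod_R. unfold unit_disc in Hz.
    pose proof (Rabs_pos (t - s)). pose proof (Cmod_ge_0 z). nra. }
  pose proof (cond_pos (delta s)).
  apply (Hdelta s Hs); [lra|].
  replace (t * (z + h) - s * z) with ((t * z - s * z) + t * h) by ring.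
  eapply Rle_lt_trans; [apply Cmod_triangle|].
  rewrite (Cmod_mult t h), Cmod_R, Rabs_pos_eq by lra.
  pose proof (Cmod_ge_0 h). nra.
Qed.

Lemma analytic_at_uniform_linear (f : C -> C) (a : C) (eps : posreal) :
  analytic_at f a -> exists d : posreal, forall x y,
    (Cmod (x - a) < d)%R -> (Cmod (y - a) < d)%R ->
    (Cmod (f y - f x - (y - x) * C_derive f x) <= eps * Cmod (y - x))%R /\
    (Cmod (f y - f x) <= eps)%R.
Proof.
  intros H. pose proof (cond_pos eps) as He.
  destruct (analytic_at_quadratic f a H) as (d & K & Q).
  assert (He2 : (0 < eps / 2)%R) by lra.
  destruct (Ccontinuous_eps f a (analytic_at_continuous f a H) (mkposreal _ He2)) as [e E].
  simpl in E.
  (* Two points this close to [a] differ by at most [eps / (Rabs K + 1)], so one factor of the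
     quadratic bound is absorbed into [eps]. *)
  assert (Hk : (0 < eps / (2 * (Rabs K + 1)))%R).
  { pose proof (Rabs_pos K). apply Rdiv_lt_0_compat; lra. }
  assert (Hm : (0 < Rmin d (Rmin e (eps / (2 * (Rabs K + 1)))))%R).
  { repeat apply Rmin_pos; try apply cond_pos. exact Hk. }
  exists (mkposreal _ Hm). simpl. intros x y Hx Hy.
  pose proof (Rmin_l d (Rmin e (eps / (2 * (Rabs K + 1))))).
  pose proof (Rmin_r d (Rmin e (eps / (2 * (Rabs K + 1))))).
  pose proof (Rmin_l e (eps / (2 * (Rabs K + 1)))).
  pose proof (Rmin_r e (eps / (2 * (Rabs K + 1)))).
  split.
  - eapply Rle_trans; [apply Q; lra|].
    assert (L : (Cmod (y - x) <= eps / (Rabs K + 1))%R).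
    { replace (y - x) with ((y - a) + - (x - a)) by ring.
      eapply Rle_trans; [apply Cmod_triangle|]. rewrite Cmod_opp.
      replace (eps / (Rabs K + 1))%R with (eps / (2 * (Rabs K + 1)) + eps / (2 * (Rabs K + 1)))%R
        by (field; pose proof (Rabs_pos K); lra).
      lra. }
    pose proof (Rabs_pos K). pose proof (Rle_abs K). pose proof (Cmod_ge_0 (y - x)).
    apply Rle_div_r in L; [|lra].
    simpl pow. rewrite Rmult_1_r, <- Rmult_assoc.
    apply Rmult_le_compat_r; [assumption|]. nra.
  - replace (f y - f x) with ((f y - f a) + - (f x - f a)) by ring.
    eapply Rle_trans; [apply Cmod_triangle|]. rewrite Cmod_opp.
    pose proof (E x ltac:(lra)). pose proof (E y ltac:(lra)). lra.
Qed.

(* Differentiation under the integral sign: the integrand of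
   [F (z + h) - F z - h * f z] is [h * (f y - f x) + z * r], where [x = t z],
   [y = t (z + h)] and [r] is the first-order Taylor remainder of [f] from [x]
   to [y]. *)
Lemma is_Cderive_integral_from_0 (f : C -> C) : analytic_on_disc f ->
  forall z, unit_disc z -> is_Cderive (integral_from_0 f) z (f z).
Proof.
  intros Hf z Hz. apply is_Cderive_eps. intros eps.
  pose proof (cond_pos eps) as He.
  assert (He2 : (0 < eps / 2)%R) by lra.
  destruct (radius_uniformity _
    (fun a Ha => analytic_at_uniform_linear f a (mkposreal _ He2) (Hf a Ha)) z Hz) as [d Hd].
  simpl in Hd.
  destruct (unit_disc_open z Hz) as [e Hopen].
  exists (mkposreal _ (Rmin_pos _ _ (cond_pos d) (cond_pos e))). simpl.
  intros w Hw. pose proof (Rmin_l d e). pose proof (Rmin_r d e).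
  assert (Hw' : unit_disc w) by (apply Hopen; lra).
  assert (I : forall v, unit_disc v -> is_RInt (V := C_R_CompleteNormedModule)
    (fun t : R => v * f (t * v)) 0 1 (integral_from_0 f v)).
  { intros v Hv. apply RInt_correct, (ex_RInt_continuous (V := C_R_CompleteNormedModule)).
    intros t Ht. rewrite Rmin_left, Rmax_right in Ht by lra.
    apply (continuous_ext (U := C_R_NormedModule) (fun t : R => v * f (0 + t * v))).
    { intros s. now rewrite Cplus_0_l. }
    apply (continuous_along_segment (fun u => v * f u)).
    apply Ccontinuous_mult; [apply Ccontinuous_const|].
    apply analytic_at_continuous, Hf. rewrite Cplus_0_l. now apply unit_disc_scal. }
  set (h := w - z).
  (* The integrand is the [t]-derivative of [t * (h * f (t * z))], so its integral is the boundary
     value [h * f z]. *)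
  assert (J : is_RInt (V := C_R_CompleteNormedModule)
    (fun t : R => h * f (t * z) + t * (z * (h * C_derive f (t * z)))) 0 1 (h * f z)).
  { replace (h * f z) with (minus (scal (V := C_R_ModuleSpace) 1%R (h * f (0 + 1%R * z)))
      (scal (V := C_R_ModuleSpace) 0%R (h * f (0 + 0%R * z)))).
    - apply (is_RInt_ext (V := C_R_CompleteNormedModule) (fun t : R =>
        plus (scal (V := C_R_ModuleSpace) 1%R (h * f (0 + t * z)))
          (scal (V := C_R_ModuleSpace) t (z * (h * C_derive f (0 + t * z)))))).
      { intros t _. rewrite !scal_R_Cmult, Cplus_0_l.
        change (1 * (h * f (t * z)) + t * (z * (h * C_derive f (t * z))) =
          h * f (t * z) + t * (z * (h * C_derive f (t * z)))). ring. }
      apply (is_RInt_scal_derive (V := C_R_CompleteNormedModule)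
        (fun t : R => t) (fun t : R => h * f (0 + t * z)) (fun _ => 1%R)
        (fun t : R => z * (h * C_derive f (0 + t * z)))); intros t Ht;
        rewrite Rmin_left, Rmax_right in Ht by lra;
        pose proof (unit_disc_scal z t Hz Ht) as Htz; rewrite <- (Cplus_0_l (t * z)) in Htz.
      + apply (is_derive_id (K := R_AbsRing)).
      + apply (is_derive_along_segment (fun u => h * f u)).
        apply is_Cderive_scal, analytic_at_is_Cderive, Hf, Htz.
      + apply continuous_const.
      + apply (continuous_along_segment (fun u => z * (h * C_derive f u))).
        apply Ccontinuous_mult; [apply Ccontinuous_const|].
        apply Ccontinuous_mult; [apply Ccontinuous_const|].
        apply analytic_at_continuous, analytic_at_derive, Hf, Htz.
    - rewrite !scal_R_Cmult.
      replace (0 + 1%R * z) with z by ring.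
      change (1 * (h * f z) - 0 * (h * f (0 + 0%R * z)) = h * f z). ring. }
  pose proof (is_RInt_minus (V := C_R_CompleteNormedModule) _ _ _ _ _ _
    (is_RInt_minus (V := C_R_CompleteNormedModule) _ _ _ _ _ _ (I w Hw') (I z Hz)) J) as D.
  assert (N : (norm (V := C_R_NormedModule)
    (minus (minus (integral_from_0 f w) (integral_from_0 f z)) (h * f z)%C)
    <= (1 - 0) * (eps * Cmod h))%R).
  { refine (norm_RInt_le_const (V := C_R_CompleteNormedModule) _ 0 1 _ _ Rle_0_1 _ D).
    intros t Ht.
    destruct (Hd t h Ht ltac:(unfold h; lra)) as [A1 A2].
    replace (z + h) with w in A1, A2 by (unfold h; ring).
    eapply Rle_trans; [apply Req_le; symmetry; apply Cmod_norm|].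
    change (Rle (Cmod (w * f (t * w) - z * f (t * z) -
      (h * f (t * z) + t * (z * (h * C_derive f (t * z)))))) (eps * Cmod h)).
    replace (w * f (t * w) - z * f (t * z) -
        (h * f (t * z) + t * (z * (h * C_derive f (t * z)))))
      with (h * (f (t * w) - f (t * z)) +
        z * (f (t * w) - f (t * z) - (t * w - t * z) * C_derive f (t * z)))
      by (unfold h; ring).
    eapply Rle_trans; [apply Cmod_triangle|]. rewrite (Cmod_mult h), (Cmod_mult z).
    replace (t * w - t * z) with (t * h) in A1 |- * by (unfold h; ring).
    rewrite (Cmod_mult t h), Cmod_R, Rabs_pos_eq in A1 by lra.
    pose proof (Cmod_ge_0 h). pose proof (Cmod_ge_0 z). unfold unit_disc in Hz.
    set (r := Cmod (f (t * w) - f (t * z) - t * h * C_derive f (t * z))) in *.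
    assert (0 <= r)%R by apply Cmod_ge_0.
    assert (r <= eps / 2 * Cmod h)%R.
    { eapply Rle_trans; [exact A1|]. apply Rmult_le_compat_l; [lra | nra]. }
    (* The two parts of the integrand contribute [eps / 2 * Cmod h] each; here [Cmod z < 1] is
       used. *)
    assert (Cmod z * r <= eps / 2 * Cmod h)%R by nra.
    pose proof (Rmult_le_compat_l (Cmod h) _ _ (Cmod_ge_0 h) A2).
    lra. }
  apply (Rle_trans _ (norm (V := C_R_NormedModule)
    (minus (minus (integral_from_0 f w) (integral_from_0 f z)) (h * f z)%C))).
  - apply Req_le. exact (Cmod_norm (integral_from_0 f w - integral_from_0 f z - h * f z)).
  - lra.
Qed.

(** Near each point the integral and a power series primitive have the same derivative, hence differ
    by a constant. *)
Lemma analytic_integral_from_0 (f : C -> C) :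
  analytic_on_disc f -> analytic_on_disc (integral_from_0 f).
Proof.
  intros Hf a Ha.
  destruct (analytic_at_primitive f a (Hf a Ha)) as (P & d & HP & DP).
  destruct (unit_disc_open a Ha) as [e Hopen].
  set (m := mkposreal _ (Rmin_pos _ _ (cond_pos d) (cond_pos e))).
  set (H := fun z => integral_from_0 f z + (-1) * P z).
  assert (HD : forall z, (Cmod (z - a) < m)%R -> is_Cderive H z 0).
  { simpl. intros z Hz. pose proof (Rmin_l d e). pose proof (Rmin_r d e).
    replace (RtoC 0) with (f z + (-1) * f z) by ring.
    apply is_Cderive_plus.
    - apply is_Cderive_integral_from_0; [exact Hf | apply Hopen; lra].
    - apply is_Cderive_scal, DP. lra. }
  apply (analytic_at_ext_near (fun z => P z + H a) _ a m).
  - intros z Hz. rewrite <- (zero_derivative_constant H a m HD z Hz). unfold H. ring.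
  - apply analytic_at_plus; [exact HP | apply analytic_at_const].
Qed.

(** * The Riccati equation *)

Lemma is_Cderive_eq_on_disc (f g : C -> C) (z l : C) :
  eq_on_disc f g -> unit_disc z -> is_Cderive f z l -> is_Cderive g z l.
Proof.
  intros E Hz. destruct (unit_disc_open z Hz) as [d Hd].
  apply is_Cderive_ext_near with d. intros y Hy. apply E, Hd, Hy.
Qed.

Lemma double_integral_from_0 (f r : C -> C) : analytic_on_disc f ->
  eq_on_disc r (C_derive (C_derive f)) ->
  eq_on_disc (integral_from_0 (integral_from_0 r))
    (fun z => f z - f 0 - C_derive f 0 * z).
Proof.
  intros Hf Hr z Hz.
  assert (I1 : eq_on_disc (integral_from_0 r) (fun y => C_derive f y - C_derive f 0)).
  { intros y Hy. rewrite (integral_from_0_ext r _ Hr y Hy).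
    apply (integral_from_0_of_derivative (C_derive f)); [|exact Hy].
    intros x Hx. pose proof (analytic_at_derive f x (Hf x Hx)) as Hf'. split.
    - now apply analytic_at_is_Cderive.
    - now apply analytic_at_continuous, analytic_at_derive. }
  rewrite (integral_from_0_ext _ _ I1 z Hz).
  rewrite (integral_from_0_of_derivative (fun y => f y + - C_derive f 0 * y)); [ring| |exact Hz].
  intros x Hx. split.
  - replace (C_derive f x - C_derive f 0) with (C_derive f x + - C_derive f 0 * 1) by ring.
    apply is_Cderive_plus.
    + apply analytic_at_is_Cderive, Hf, Hx.
    + apply is_Cderive_scal, is_Cderive_id.
  - apply Ccontinuous_plus; [|apply Ccontinuous_const].
    apply analytic_at_continuous, analytic_at_derive, Hf, Hx.
Qed.

Lemma C_derive_combination (k l : C) (f g : C -> C) :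
  analytic_on_disc f -> analytic_on_disc g ->
  eq_on_disc (C_derive (fun z => k * f z + l * g z))
    (fun z => k * C_derive f z + l * C_derive g z).
Proof.
  intros Hf Hg z Hz. apply C_derive_unique.
  apply is_Cderive_plus; apply is_Cderive_scal, analytic_at_is_Cderive; auto.
Qed.

Lemma C_derive2_combination (k l : C) (f g : C -> C) :
  analytic_on_disc f -> analytic_on_disc g ->
  eq_on_disc (C_derive (C_derive (fun z => k * f z + l * g z)))
    (fun z => k * C_derive (C_derive f) z + l * C_derive (C_derive g) z).
Proof.
  intros Hf Hg z Hz. apply C_derive_unique.
  apply is_Cderive_eq_on_disc with (fun z => k * C_derive f z + l * C_derive g z); [|exact Hz|].
  - intros y Hy. symmetry. now apply C_derive_combination.
  - apply is_Cderive_plus; apply is_Cderive_scal, analytic_at_is_Cderive, analytic_at_derive; auto.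
Qed.

Lemma C_derive_integral_from_0 (f : C -> C) : analytic_on_disc f ->
  eq_on_disc (C_derive (integral_from_0 f)) f.
Proof. intros Hf z Hz. now apply C_derive_unique, is_Cderive_integral_from_0. Qed.

Lemma admissible_quadratic_equation (X : (C -> C) -> Prop) (f1 f2 h : C -> C) :
  admissible X -> X f1 -> X f2 -> analytic_on_disc h ->
  (forall z, unit_disc z -> C_derive (C_derive h) z =
     C_derive (C_derive f1) z + C_derive f2 z * C_derive h z + C_derive h z ^ 2) ->
  X h.
Proof.
  intros [[Xan Xext Xzero Xadd Xscal] Xpoly XR] X1 X2 Hh Hode.
  set (u := fun z => / 2 * f2 z).
  assert (Xu : X u) by (now apply Xscal).
  assert (Hu : analytic_on_disc u) by auto.
  set (q := fun z => - C_derive (C_derive u) z - C_derive u z ^ 2).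
  assert (Hq : analytic_on_disc q).
  { intros a Ha. pose proof (analytic_at_derive u a (Hu a Ha)) as Hu'.
    apply (analytic_at_ext_near (fun z => (-1) * C_derive (C_derive u) z
      + (-1) * (C_derive u z * C_derive u z)) _ a (mkposreal 1 Rlt_0_1)).
    - intros z _. unfold q. simpl. ring.
    - apply analytic_at_plus; apply analytic_at_scal.
      + now apply analytic_at_derive.
      + now apply analytic_at_mult. }
  set (v := fun z => (-1) * h z + (-1) * u z).
  assert (Hv : analytic_on_disc v).
  { intros a Ha. apply analytic_at_plus; apply analytic_at_scal; auto. }
  assert (Xv : X v).
  (* Admissibility serves in both directions: from [riccati_op v] back to [v] here, and from [u] to
     [riccati_op u] in [Xp]. *)
  { apply (XR v Hv).
    (* The coefficients [1] make [s] and [p] literal instances of [C_derive2_combination]. *)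
    set (s := fun z => 1 * f1 z + 1 * f2 z).
    assert (Xs : X s) by (apply Xadd; now apply Xscal).
    assert (Hs : analytic_on_disc s) by auto.
    set (p := fun z => 1 * s z + 1 * riccati_op u z).
    assert (Xp : X p).
    { apply Xadd; apply Xscal; [exact Xs | exact (proj1 (XR u Hu) Xu)]. }
    assert (Hp : analytic_on_disc p) by auto.
    assert (HIq : analytic_on_disc (integral_from_0 q)) by now apply analytic_integral_from_0.
    assert (Hr : eq_on_disc (fun z => - C_derive (C_derive v) z - C_derive v z ^ 2)
      (C_derive (C_derive p))).
    { intros z Hz.
      unfold p. rewrite (C_derive2_combination 1 1 s (riccati_op u)); auto;
        [|now apply analytic_integral_from_0].
      assert (E : C_derive (C_derive (riccati_op u)) z = q z).
      { rewrite <- (C_derive_integral_from_0 q Hq z Hz).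
        apply C_derive_unique, is_Cderive_eq_on_disc with (integral_from_0 q); [|exact Hz|].
        - intros y Hy. symmetry. now apply (C_derive_integral_from_0 (integral_from_0 q)).
        - rewrite (C_derive_integral_from_0 q Hq z Hz).
          now apply is_Cderive_integral_from_0. }
      rewrite E. unfold s. rewrite (C_derive2_combination 1 1 f1 f2); auto.
      unfold v. rewrite (C_derive2_combination (-1) (-1) h u); auto.
      rewrite (C_derive_combination (-1) (-1) h u); auto.
      rewrite Hode by exact Hz. unfold q.
      (* Once [f2' = 2 u'] and [f2'' = 2 u''], the terms in [h'] cancel and both sides become
         [f1'' + u'' - u'^2]. *)
      assert (U1 : forall y, unit_disc y -> C_derive f2 y = 2 * C_derive u y).
      { intros y Hy. rewrite (C_derive_unique u y (/ 2 * C_derive f2 y)).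
        - field.
        - now apply is_Cderive_scal, analytic_at_is_Cderive, Xan. }
      assert (U2 : C_derive (C_derive f2) z = 2 * C_derive (C_derive u) z).
      { apply C_derive_unique.
        apply is_Cderive_eq_on_disc with (fun y => 2 * C_derive u y); [|exact Hz|].
        - intros y Hy. symmetry. now apply U1.
        - apply is_Cderive_scal, analytic_at_is_Cderive, analytic_at_derive, Hu, Hz. }
      rewrite (U1 z Hz), U2. simpl. ring. }
    (* By [double_integral_from_0], [riccati_op v] is [p] minus its Taylor polynomial of degree one
       at [0], written as the two-term sum that [Xpoly] accepts. *)
    apply (Xext (fun z => p z + sum_n (fun n =>
      match n with O => - p 0 | _ => - C_derive p 0 end * z ^ n) 1)).
    - intros z Hz. unfold riccati_op.
      rewrite (double_integral_from_0 p _ Hp Hr z Hz).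
      rewrite sum_Sn, sum_O.
      change (p z + (- p 0 * z ^ 0 + - C_derive p 0 * z ^ 1) = p z - p 0 - C_derive p 0 * z).
      simpl. ring.
    - apply Xadd; [exact Xp|].
      apply (Xpoly 1%nat (fun n => match n with O => - p 0 | _ => - C_derive p 0 end)). }
  apply (Xext (fun z => (-1) * v z + (-1) * u z)).
  - intros z _. unfold v. ring.
  - apply Xadd; now apply Xscal.
Qed.

(** * Removal of the poles by density and continuity *)

Lemma punctured_ball_nonempty (a : C) (d : posreal) :
  exists z, (Cmod (z - a) < d)%R /\ z <> a.
Proof.
  pose proof (cond_pos d) as Hd.
  assert (E : Cmod (a + RtoC (d / 2) - a) = (d / 2)%R).
  { replace (a + RtoC (d / 2) - a) with (RtoC (d / 2)) by ring.
    rewrite Cmod_R. apply Rabs_pos_eq. lra. }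
  exists (a + RtoC (d / 2)). split; [lra|].
  intros F. rewrite F in E. replace (a - a) with (RtoC 0) in E by ring.
  rewrite Cmod_0 in E. lra.
Qed.

Lemma continuous_vanishing (E : C -> C) (a : C) : Ccontinuous E a ->
  (forall d : posreal, exists z, (Cmod (z - a) < d)%R /\ E z = 0) -> E a = 0.
Proof.
  intros HE H. apply NNPP. intros N.
  destruct (Ccontinuous_eps E a HE (mkposreal _ (proj1 (Cmod_gt_0 (E a)) N))) as [d Hd].
  destruct (H d) as (z & Hz & Ez).
  specialize (Hd z Hz). simpl in Hd. rewrite Ez in Hd.
  replace (0 - E a) with (- E a) in Hd by ring. rewrite Cmod_opp in Hd. lra.
Qed.

(* The identity is immediate off the zeros of [Cf] and the exceptional points;
   on a disc where [Cf] vanishes identically both sides are zero. These two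
   cases cover a dense set, and both sides are continuous. *)
Lemma riccati_normal_form (A B Cf g G1 G2 : C -> C) :
  analytic_on_disc Cf -> analytic_on_disc g ->
  analytic_on_disc G1 -> analytic_on_disc G2 ->
  mero_eq (fun z => A z * Cf z) G1 ->
  mero_eq (fun z => B z + C_derive Cf z / Cf z) G2 ->
  mero_eq (C_derive (C_derive g))
    (fun z => A z + B z * C_derive g z + Cf z * C_derive g z ^ 2) ->
  forall z, unit_disc z ->
    C_derive (fun y => Cf y * C_derive g y) z =
    G1 z + G2 z * (Cf z * C_derive g z) + (Cf z * C_derive g z) ^ 2.
Proof.
  intros HC Hg H1 H2 E1 E2 E3 a Ha.
  set (w := fun y => Cf y * C_derive g y).
  assert (Hw : analytic_on_disc w).
  { intros b Hb. apply analytic_at_mult; [|apply analytic_at_derive]; auto. }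
  assert (Dw : forall z, unit_disc z ->
    C_derive w z = C_derive Cf z * C_derive g z + Cf z * C_derive (C_derive g) z).
  { intros z Hz. apply C_derive_unique, is_Cderive_mult; apply analytic_at_is_Cderive;
      [|apply analytic_at_derive]; auto. }
  set (E := fun z => C_derive w z + ((-1) * G1 z + (-1) * (G2 z * w z + w z * w z))).
  enough (EZ : E a = 0).
  { unfold E in EZ. fold (w a).
    replace (C_derive w a) with (E a + (G1 a + G2 a * w a + w a ^ 2)) by (unfold E; simpl; ring).
    unfold E. rewrite EZ. ring. }
  apply continuous_vanishing.
  { apply analytic_at_continuous.
    apply analytic_at_plus; [apply analytic_at_derive; auto|].
    apply analytic_at_plus; apply analytic_at_scal; auto.
    apply analytic_at_plus; apply analytic_at_mult; auto. }
  intros d0. destruct (unit_disc_open a Ha) as [d1 Hopen].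
  set (d := Rmin d0 d1).
  assert (Hd : (0 < d)%R) by (apply Rmin_pos; apply cond_pos).
  assert (Hd0 : (d <= d0)%R) by apply Rmin_l.
  assert (Hd1 : (d <= d1)%R) by apply Rmin_r.
  destruct (classic (exists b, (Cmod (b - a) < d)%R /\ Cf b <> 0)) as [(b & Hb & Cb)|N].
  - assert (Ub : unit_disc b) by (apply Hopen; lra).
    destruct (proj1 (locally'_Cmod _ _) (E1 b Ub)) as [e1 F1].
    destruct (proj1 (locally'_Cmod _ _) (E2 b Ub)) as [e2 F2].
    destruct (proj1 (locally'_Cmod _ _) (E3 b Ub)) as [e3 F3].
    (* Within [e4] of [b] the function [Cf] stays nonzero, so a point of the punctured disc around
       [b] avoids all exceptional points and allows division by [Cf]. *)
    destruct (Ccontinuous_eps Cf b (analytic_at_continuous _ _ (HC b Ub))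
      (mkposreal _ (proj1 (Cmod_gt_0 (Cf b)) Cb))) as [e4 F4]. simpl in F4.
    assert (Hm : (0 < Rmin (Rmin e1 e2) (Rmin (Rmin e3 e4) (d - Cmod (b - a))))%R).
    { repeat apply Rmin_pos; try apply cond_pos. lra. }
    destruct (punctured_ball_nonempty b (mkposreal _ Hm)) as (z & Hz & zb). simpl in Hz.
    apply Rmin_Rgt in Hz. destruct Hz as [Hz12 Hz].
    apply Rmin_Rgt in Hz12. destruct Hz12 as [Hz1 Hz2].
    apply Rmin_Rgt in Hz. destruct Hz as [Hz34 Hz].
    apply Rmin_Rgt in Hz34. destruct Hz34 as [Hz3 Hz4].
    assert (Hza : (Cmod (z - a) < d)%R).
    { replace (z - a) with ((z - b) + (b - a)) by ring.
      eapply Rle_lt_trans; [apply Cmod_triangle | lra]. }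
    exists z. split; [lra|].
    assert (Cz : Cf z <> 0).
    { intros F. specialize (F4 z Hz4). rewrite F in F4.
      replace (0 - Cf b) with (- Cf b) in F4 by ring. rewrite Cmod_opp in F4. lra. }
    unfold E. rewrite Dw by (apply Hopen; lra).
    rewrite (F3 z Hz3 zb), <- (F1 z Hz1 zb), <- (F2 z Hz2 zb).
    unfold w. field. exact Cz.
  - assert (Z : forall z, (Cmod (z - a) < d)%R -> Cf z = 0).
    { intros z Hz. apply NNPP. intros F. apply N. now exists z. }
    (* The vanishing of [G1] comes from [G1 = A * Cf], so [z] must avoid the possible exceptional
       point [a] of [E1]. *)
    destruct (proj1 (locally'_Cmod _ _) (E1 a Ha)) as [e1 F1].
    destruct (punctured_ball_nonempty a (mkposreal _ (Rmin_pos _ _ Hd (cond_pos e1))))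
      as (z & Hz & za). simpl in Hz.
    apply Rmin_Rgt in Hz. destruct Hz as [Hz Hz1].
    exists z. split; [lra|].
    assert (Hr : (0 < d - Cmod (z - a))%R) by lra.
    assert (DC : C_derive Cf z = 0).
    { apply C_derive_unique, is_Cderive_ext_near with (fun _ => 0) (mkposreal _ Hr);
        [|apply is_Cderive_const].
      simpl. intros y Hy. symmetry. apply Z.
      replace (y - a) with ((y - z) + (z - a)) by ring.
      eapply Rle_lt_trans; [apply Cmod_triangle | lra]. }
    unfold E. rewrite Dw by (apply Hopen; lra).
    rewrite DC, <- (F1 z Hz1 za). unfold w. rewrite (Z z Hz). ring.
Qed.

Local Close Scope C_scope.

Theorem theorem8 (X : (C -> C) -> Prop) (A B Cf g : C -> C)
  (hX : admissible X)
  (hA : meromorphic_on_disc A)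
  (hB : meromorphic_on_disc B)
  (hC : analytic_on_disc Cf)
  (hC0 : exists z : C, unit_disc z /\ Cf z <> RtoC 0)
  (hAC : mem_removing_singularities (second_derivatives X)
           (fun z => (A z * Cf z)%C))
  (hBC : mem_removing_singularities (first_derivatives X)
           (fun z => (B z + C_derive Cf z / Cf z)%C))
  (hg : analytic_on_disc g)
  (hode : mero_eq (C_derive (C_derive g))
            (fun z => (A z + B z * C_derive g z + Cf z * C_derive g z ^ 2)%C)) :
  first_derivatives X (fun z => (Cf z * C_derive g z)%C).
Proof.
  Local Open Scope C_scope.
  destruct hAC as (G1 & (f1 & X1 & D1) & E1).
  destruct hBC as (G2 & (f2 & X2 & D2) & E2).
  pose proof (subspace_analytic X (admissible_subspace X hX)) as Xan.
  (* [G1] and [G2] agree with derivatives of [f1] and [f2] only on the disc; openness of the disc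
     lets [mero_eq] pass to those derivatives. *)
  assert (R : forall G G' F, eq_on_disc G G' -> mero_eq F G -> mero_eq F G').
  { intros G G' F HG HF a Ha. destruct (unit_disc_open a Ha) as [d Hd].
    destruct (proj1 (locally'_Cmod _ _) (HF a Ha)) as [e He].
    apply locally'_Cmod. exists (mkposreal _ (Rmin_pos _ _ (cond_pos d) (cond_pos e))).
    simpl. intros z Hz za. apply Rmin_Rgt in Hz. destruct Hz as [Hz1 Hz2].
    rewrite <- HG by (now apply Hd). now apply He. }
  set (w := fun z => Cf z * C_derive g z).
  assert (Hw : analytic_on_disc w).
  { intros b Hb. apply analytic_at_mult; [|apply analytic_at_derive]; auto. }
  pose proof (C_derive_integral_from_0 w Hw) as Dh.
  (* The required member of [X] is the primitive of [w] vanishing at [0], playing the role of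
     [h]. *)
  exists (integral_from_0 w). split; [|intros z Hz; symmetry; now apply Dh].
  apply (admissible_quadratic_equation X f1 f2); auto using analytic_integral_from_0.
  intros z Hz.
  rewrite (Dh z Hz).
  rewrite (C_derive_unique (C_derive (integral_from_0 w)) z (C_derive w z)).
  - apply (riccati_normal_form A B Cf g (C_derive (C_derive f1)) (C_derive f2)); auto.
    + intros a Ha. now apply analytic_at_derive, analytic_at_derive, Xan.
    + intros a Ha. now apply analytic_at_derive, Xan.
    + now apply R with G1.
    + now apply R with G2.
  - apply is_Cderive_eq_on_disc with w; [|exact Hz|].
    + intros y Hy. symmetry. now apply Dh.
    + apply analytic_at_is_Cderive, Hw, Hz.
Qed.
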